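(* Let $P(x,y)=\sum_{\ell_1,\ell_2}x^{\ell_1}y^{\ell_2}a_{\ell_1,\ell_2}$ be a slice regular quaternionic polynomial in two variables with coefficients $a_{\ell_1,\ell_2}\in\mathbb{H}$ not all zero. Then $\log|P|$ is integrable on $\mathbb{T}^2(\mathbb{H})$, so $m_{\mathbb{H}}(P)$ exists (as an absolutely convergent improper integral).
   Context: $\mathbb{H}$ denotes the quaternions, $\mathbb{T}^2(\mathbb{H})=\{(x,y)\in\mathbb{H}^2:|x|=|y|=1\}$ with probability Haar measure $\mu$, and $m_{\mathbb{H}}(P)=\int_{\mathbb{T}^2(\mathbb{H})}\log|P(x,y)|\,d\mu$. The polynomial is evaluated with quaternion multiplication in the written order $x^{\ell_1}y^{\ell_2}a_{\ell_1,\ell_2}$. *)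

(* Defs.v *)
From HB Require Import structures.
From mathcomp Require Import all_boot all_order all_algebra.
From mathcomp Require Import all_classical all_reals all_analysis.
Set Implicit Arguments. Unset Strict Implicit. Unset Printing Implicit Defensive.
Import Order.TTheory GRing.Theory Num.Theory.
Import numFieldNormedType.Exports.
Local Open Scope classical_set_scope.
Local Open Scope ring_scope.

Notation quat R := ((R * R) * (R * R))%type.

Section Quaternions.
Variable R : realType.

Definition qmk (a b c d : R) : quat R := ((a, b), (c, d)).
Definition qre (q : quat R) : R := q.1.1.
Definition qi  (q : quat R) : R := q.1.2.
Definition qj  (q : quat R) : R := q.2.1.
Definition qk  (q : quat R) : R := q.2.2.

Definition qzero : quat R := qmk 0 0 0 0.
Definition qone  : quat R := qmk 1 0 0 0.
Definition qadd (p q : quat R) : quat R :=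
  qmk (qre p + qre q) (qi p + qi q) (qj p + qj q) (qk p + qk q).
(* Hamilton product: i^2 = j^2 = k^2 = ijk = -1. *)
Definition qmul (p q : quat R) : quat R :=
  qmk (qre p * qre q - qi p * qi q - qj p * qj q - qk p * qk q)
      (qre p * qi q + qi p * qre q + qj p * qk q - qk p * qj q)
      (qre p * qj q - qi p * qk q + qj p * qre q + qk p * qi q)
      (qre p * qk q + qi p * qj q - qj p * qi q + qk p * qre q).
Fixpoint qexp (q : quat R) (n : nat) : quat R :=
  if n is n'.+1 then qmul (qexp q n') q else qone.
Definition qnorm (q : quat R) : R :=
  Num.sqrt (qre q ^+ 2 + qi q ^+ 2 + qj q ^+ 2 + qk q ^+ 2).
Definition qscale (t : R) (q : quat R) : quat R :=
  qmk (t * qre q) (t * qi q) (t * qj q) (t * qk q).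

Definition qpoly2 (n1 n2 : nat) (a : nat -> nat -> quat R) (x y : quat R)
  : quat R :=
  \big[qadd/qzero]_(l1 < n1) \big[qadd/qzero]_(l2 < n2)
     qmul (qmul (qexp x l1) (qexp y l2)) (a l1 l2).

Definition leb4 : set (quat R) -> \bar R :=
  ((@lebesgue_measure R \x @lebesgue_measure R) \x
   (@lebesgue_measure R \x @lebesgue_measure R))%E.

Definition unit_ball4 : set (quat R) := [set q | qnorm q <= 1].

(* Normalized (probability) surface measure on the unit sphere S^3 of H,
   defined as the normalized cone measure:
   sigma(A) = vol{ t u : 0 < t <= 1, u in A, |u| = 1 } / vol(B^4). *)
Definition sphere3_measure (A : set (quat R)) : \bar R :=
  ((fine (leb4 unit_ball4))^-1)%:E *
  leb4 [set q | ((0 < qnorm q <= 1) /\ A (qscale (qnorm q)^-1 q))%R].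

(* Probability Haar measure on T^2(H) = S^3 x S^3 (product of the Haar
   measures of the unit quaternion group S^3). *)
Definition haarT2 : set (quat R * quat R) -> \bar R :=
  (sphere3_measure \x sphere3_measure)%E.

Definition torus2H : set (quat R * quat R) :=
  [set p | qnorm p.1 = 1 /\ qnorm p.2 = 1].

Definition elog_norm (q : quat R) : \bar R :=
  if qnorm q == 0 then (-oo)%E else (ln (qnorm q))%:E.

End Quaternions.

(* Main.v *)
Require Import Defs.
From HB Require Import structures.
From mathcomp Require Import all_boot all_order all_algebra.
From mathcomp Require Import all_classical all_reals all_analysis.
From mathcomp Require Import measurable_realfun complex ring lra zify.
Set Implicit Arguments. Unset Strict Implicit. Unset Printing Implicit Defensive.
Import Order.TTheory GRing.Theory Num.Theory.
Import numFieldNormedType.Exports.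
Local Open Scope classical_set_scope.
Local Open Scope ring_scope.

(* |P| is bounded on the torus, so only log^- |P| matters.
   One variable: for p(x) = sum_l x^l b_l of degree d and |x| = 1,
   sum_m x^m p(x) conj(b_m) = F(x) where F = sum_(l,m) <b_l, b_m> X^(l+m) has
   real coefficients and leading coefficient |b_d|^2; hence
   |F(x)| <= (sum_m |b_m|) |p(x)|.  On the complex slice through x, F splits
   over the complex numbers, and |x - z| >= |Re x - Re z| for each root z.
   Now log^- |Re x - rho| is integrable over S^3 uniformly in rho: in the ball,
   Re q = rho |q| is the quadric (1 - rho^2) Re(q)^2 = rho^2 |Im q|^2, in which
   the coefficient of Re(q)^2 or that of qk(q)^2 is at least 1/2 in absolute
   value, so that the e-sublevel sets have volume O(sqrt e).  This gives
   int log^- |p| <= K + K log^- |b_d| with K depending only on d and on a bound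
   for sum_m |b_m|.
   Two variables: for fixed y apply this to P(., y), whose top coefficient is a
   one-variable polynomial in y, then apply it again to that polynomial and
   conclude by Tonelli. *)

(** * Volume bounds from sections of product measures *)

(* The library's sigma-finiteness instance for product measures is shadowed by
   the one for products of subprobabilities, hence this alias. *)
Section ProductMeasure.
Local Open Scope ereal_scope.
Context d1 d2 (T1 : measurableType d1) (T2 : measurableType d2) (R : realType).
Variables (m1 : {sigma_finite_measure set T1 -> \bar R})
          (m2 : {sigma_finite_measure set T2 -> \bar R}).

Definition sfprod : set (T1 * T2) -> \bar R := m1 \x m2.

HB.instance Definition _ := Measure.on sfprod.

Let sfprod_sigma_finite : sigma_finite setT sfprod.
Proof.
have /sigma_finiteP[F [FT ndF mF]] := sigma_finiteT m1.
have /sigma_finiteP[G [GT ndG mG]] := sigma_finiteT m2.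
exists (fun n => F n `*` G n).
  apply/esym/seteqP; split=> // -[x y] _.
  have [i _ Fx] : (\bigcup_i F i) x by rewrite -FT.
  have [j _ Gy] : (\bigcup_j G j) y by rewrite -GT.
  exists (maxn i j) => //; split => /=.
  - exact: (subsetPset _ _ (ndF _ _ (leq_maxl i j))).
  - exact: (subsetPset _ _ (ndG _ _ (leq_maxr i j))).
move=> n; have [mFn Fn] := mF n; have [mGn Gn] := mG n.
split; first exact: measurableX.
by rewrite /sfprod product_measure1E// lte_mul_pinfty// ge0_fin_numE.
Qed.

HB.instance Definition _ :=
  Measure_isSigmaFinite.Build _ _ _ sfprod sfprod_sigma_finite.

Lemma sfprodX A B : measurable A -> measurable B -> sfprod (A `*` B) = m1 A * m2 B.
Proof. exact: product_measure1E. Qed.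

(** Cavalieri: the sections over points off [A] are empty, so the constant [k] is integrated over
    [A] only. *)
Lemma sfprod_le_xsection (E : set (T1 * T2)) (A : set T1) (k : \bar R) :
  measurable E -> measurable A -> 0 <= k -> (forall p, E p -> A p.1) ->
  (forall x, m2 (xsection E x) <= k) -> sfprod E <= k * m1 A.
Proof.
move=> mE mA k0 EA Ek.
rewrite -integral_cst// integral_mkcond/= /sfprod /product_measure1.
apply: ge0_le_integral => //.
- exact: measurable_fun_xsection.
- by apply/(measurable_restrictT _ _).1 => //; exact: measurable_cst.
move=> x _ /=; rewrite patchE; case: ifPn => // /negP xA.
rewrite (_ : xsection E x = set0) ?measure0//.
by apply/seteqP; split=> // y; rewrite /xsection/= inE => /EA/= /mem_set.
Qed.

Lemma sfprod_le_ysection (E : set (T1 * T2)) (A : set T2) (k : \bar R) :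
  measurable E -> measurable A -> 0 <= k -> (forall p, E p -> A p.2) ->
  (forall y, m1 (ysection E y) <= k) -> sfprod E <= k * m2 A.
Proof.
move=> mE mA k0 EA Ek.
(* The product is defined through x-sections; uniqueness allows y-sections to be integrated
   instead. *)
rewrite /sfprod (product_measure_unique (product_measure2E m1 m2))//.
rewrite -integral_cst// integral_mkcond/=.
apply: ge0_le_integral => //.
- exact: measurable_fun_ysection.
- by apply/(measurable_restrictT _ _).1 => //; exact: measurable_cst.
move=> y _ /=; rewrite patchE; case: ifPn => // /negP yA.
rewrite (_ : ysection E y = set0) ?measure0//.
by apply/seteqP; split=> // x; rewrite /ysection/= inE => /EA/= /mem_set.
Qed.

End ProductMeasure.

(** * The cone measure on the unit sphere as a finite measure *)

Section Sphere.
Variable R : realType.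
Implicit Types (p q x y : quat R) (A : set (quat R)).

Lemma qnorm_ge0 q : 0 <= qnorm q. Proof. exact: sqrtr_ge0. Qed.

Lemma sqr_qnorm q : qnorm q ^+ 2 = qre q ^+ 2 + qi q ^+ 2 + qj q ^+ 2 + qk q ^+ 2.
Proof. by rewrite sqr_sqrtr// !addr_ge0// sqr_ge0. Qed.

Lemma measurable_qre : measurable_fun [set: quat R] (@qre R).
Proof. exact: (measurableT_comp measurable_fst measurable_fst). Qed.
Lemma measurable_qi : measurable_fun [set: quat R] (@qi R).
Proof. exact: (measurableT_comp measurable_snd measurable_fst). Qed.
Lemma measurable_qj : measurable_fun [set: quat R] (@qj R).
Proof. exact: (measurableT_comp measurable_fst measurable_snd). Qed.
Lemma measurable_qk : measurable_fun [set: quat R] (@qk R).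
Proof. exact: (measurableT_comp measurable_snd measurable_snd). Qed.

Section Measurability.
Context d (T : measurableType d).
Implicit Types f g : T -> quat R.

Lemma measurable_qmk (a b c e : T -> R) :
  measurable_fun setT a -> measurable_fun setT b ->
  measurable_fun setT c -> measurable_fun setT e ->
  measurable_fun setT (fun t => qmk (a t) (b t) (c t) (e t)).
Proof. by move=> *; apply: measurable_fun_pair; exact: measurable_fun_pair. Qed.

Lemma measurable_coords f : measurable_fun setT f ->
  [/\ measurable_fun setT (fun t => qre (f t)),
      measurable_fun setT (fun t => qi (f t)),
      measurable_fun setT (fun t => qj (f t)) &
      measurable_fun setT (fun t => qk (f t))].
Proof.
move=> mf; split.
- exact: (measurableT_comp measurable_qre mf).
- exact: (measurableT_comp measurable_qi mf).
- exact: (measurableT_comp measurable_qj mf).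
- exact: (measurableT_comp measurable_qk mf).
Qed.

Lemma measurable_qnorm f : measurable_fun setT f ->
  measurable_fun setT (fun t => qnorm (f t)).
Proof.
move=> /measurable_coords[? ? ? ?].
apply: (measurableT_comp (f := @Num.sqrt R)).
  by apply: continuous_measurable_fun; exact: sqrt_continuous.
by do ![apply: measurable_funD]; exact: measurable_funX.
Qed.

Lemma measurable_qmul f g : measurable_fun setT f -> measurable_fun setT g ->
  measurable_fun setT (fun t => qmul (f t) (g t)).
Proof.
move=> /measurable_coords[? ? ? ?] /measurable_coords[? ? ? ?].
by apply: measurable_qmk;
  do ![apply: measurable_funB|apply: measurable_funD]; exact: measurable_funM.
Qed.

Lemma measurable_qexp n f : measurable_fun setT f ->
  measurable_fun setT (fun t => qexp (f t) n).
Proof.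
move=> mf; elim: n => [|n ih]/=; first exact: measurable_cst.
exact: measurable_qmul.
Qed.

Lemma measurable_qsum n (f : 'I_n -> T -> quat R) :
  (forall i, measurable_fun setT (f i)) ->
  measurable_fun setT (fun t => \sum_(i < n) f i t).
Proof.
move=> mf; elim: n f mf => [|n ih] f mf.
  by under eq_fun do rewrite big_ord0; exact: measurable_cst.
under eq_fun do rewrite big_ord_recr/=.
have /measurable_coords[? ? ? ?] := ih _ (fun i => mf (widen_ord (leqnSn n) i)).
have /measurable_coords[? ? ? ?] := mf ord_max.
apply: (measurable_qmk (a := fun t => _ + _) (b := fun t => _ + _)
  (c := fun t => _ + _) (e := fun t => _ + _)); exact: measurable_funD.
Qed.

End Measurability.

Definition normalize q := qscale (qnorm q)^-1 q.

Lemma measurable_normalize : measurable_fun setT normalize.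
Proof.
have mid : measurable_fun [set: quat R] (fun q => q) by exact: measurable_id.
have mV : measurable_fun [set: quat R] (fun q => (qnorm q)^-1).
  (* A real power is measurable on the whole line, and both sides are 0 at the origin. *)
  have -> : (fun q => (qnorm q)^-1) = (fun q => powR (qnorm q) (- 1)).
    by apply/funext => q; rewrite powR_inv1// qnorm_ge0.
  apply: (measurableT_comp (f := (@powR R)^~ (- 1))); last exact: measurable_qnorm.
  exact: measurable_powR.
have [? ? ? ?] := measurable_coords mid.
by rewrite /normalize /qscale; apply: (measurable_qmk (a := fun q => _ * qre q)
  (b := fun q => _ * qi q) (c := fun q => _ * qj q) (e := fun q => _ * qk q));
  exact: measurable_funM.
Qed.

Definition punctured_ball : set (quat R) := [set q | 0 < qnorm q <= 1].

Lemma measurable_punctured_ball : measurable punctured_ball.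
Proof.
have -> : punctured_ball = (@qnorm R) @^-1` `]0, 1].
  by apply/seteqP; split=> q /=; rewrite in_itv.
by rewrite -[X in measurable X]setTI; apply: measurable_qnorm.
Qed.

(** Lebesgue measures bundled as sigma-finite ones: [leb4] is then convertible to [mu4], to which
    the section bounds apply. *)
Let T : measurableType _ := measurableTypeR R.
Let mu : {sigma_finite_measure set T -> \bar R} := @lebesgue_measure R.
Let mu2 : {sigma_finite_measure set (T * T)%type -> \bar R} := sfprod mu mu.
Let mu4 : {sigma_finite_measure set (T * T * (T * T))%type -> \bar R} :=
  sfprod mu2 mu2.

Let leb4E A : leb4 A = mu4 A. Proof. by []. Qed.

Lemma leb4_ge0 A : (0 <= leb4 A)%E.
Proof. exact: (measure_ge0 mu4). Qed.

Let I11 : set T := `[-1, 1]%classic.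

Let mI11 : measurable I11.
Proof. exact: measurable_itv. Qed.

Let muI11 : mu I11 = 2%:E.
Proof. rewrite /mu/= lebesgue_measure_itv/= lte_fin gtrN// -EFinD opprK//. Qed.

Let muI11sq : mu2 (I11 `*` I11) = 4%:E.
Proof. by rewrite [LHS]sfprodX// muI11 -EFinM -natrM. Qed.

(** Fubini with the last coordinate innermost; the other three run through a cube of volume 8. *)
Lemma leb4_slice_k_le A (k : R) : measurable A -> 0 <= k ->
  (forall q, A q -> [/\ `|qre q| <= 1, `|qi q| <= 1, `|qj q| <= 1 & `|qk q| <= 1]) ->
  (forall a b c : R, (mu [set e : T | A (qmk a b c e)] <= k%:E)%E) ->
  (leb4 A <= (8 * k)%:E)%E.
Proof.
move=> mA k0 Abox Ak.
(* 4 is the area of the square of the outer pair, 2 the length of the range of the third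
   coordinate. *)
have -> : (8 * k)%:E = ((k * 2)%:E * 4%:E)%E by rewrite -EFinM; congr EFin; ring.
rewrite -muI11sq.
apply: (@sfprod_le_xsection _ _ _ _ _ mu2 mu2) => //.
- exact: measurableX.
- by rewrite lee_fin mulr_ge0.
- by move=> [[a b] [c e]] /Abox[/= ? ? ? ?]; split; rewrite /I11/= in_itv/= -ler_norml.
move=> [a b]; rewrite EFinM -muI11.
have mAab : measurable (xsection (A : set (T * T * (T * T))) (a, b)).
  exact: measurable_xsection.
apply: sfprod_le_xsection => //.
- move=> [c e]; rewrite /xsection/= inE => /Abox[/= ? ? ? ?].
  by rewrite /I11/= in_itv/= -ler_norml.
move=> c; rewrite (_ : xsection _ _ = [set e : T | A (qmk a b c e)])//.
by rewrite predeqE => e; rewrite /xsection/= !inE /= !inE.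
Qed.

(** Mirror image of the previous bound, through y-sections, with the real part innermost. *)
Lemma leb4_slice_re_le A (k : R) : measurable A -> 0 <= k ->
  (forall q, A q -> [/\ `|qre q| <= 1, `|qi q| <= 1, `|qj q| <= 1 & `|qk q| <= 1]) ->
  (forall b c e : R, (mu [set a : T | A (qmk a b c e)] <= k%:E)%E) ->
  (leb4 A <= (8 * k)%:E)%E.
Proof.
move=> mA k0 Abox Ak.
have -> : (8 * k)%:E = ((k * 2)%:E * 4%:E)%E by rewrite -EFinM; congr EFin; ring.
rewrite -muI11sq.
apply: (@sfprod_le_ysection _ _ _ _ _ mu2 mu2) => //.
- exact: measurableX.
- by rewrite lee_fin mulr_ge0.
- by move=> [[a b] [c e]] /Abox[/= ? ? ? ?]; split; rewrite /I11/= in_itv/= -ler_norml.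
move=> [c e]; rewrite EFinM -muI11.
have mAce : measurable (ysection (A : set (T * T * (T * T))) (c, e)).
  exact: measurable_ysection.
apply: sfprod_le_ysection => //.
- move=> [a b]; rewrite /ysection/= inE => /Abox[/= ? ? ? ?].
  by rewrite /I11/= in_itv/= -ler_norml.
move=> b; rewrite (_ : ysection _ _ = [set a : T | A (qmk a b c e)])//.
by rewrite predeqE => a; rewrite /ysection/= !inE /= !inE.
Qed.

Lemma punctured_ball_box q : punctured_ball q ->
  [/\ `|qre q| <= 1, `|qi q| <= 1, `|qj q| <= 1 & `|qk q| <= 1].
Proof.
move=> /andP[_ q1]; have := sqr_qnorm q.
have := exprn_ile1 2 (qnorm_ge0 q) q1 => + qE.
rewrite qE => q2; have [? ? ? ?] : [/\ 0 <= qre q ^+ 2, 0 <= qi q ^+ 2,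
  0 <= qj q ^+ 2 & 0 <= qk q ^+ 2] by rewrite !sqr_ge0.
split; rewrite -(@ler_pXn2r _ 2) ?nnegrE// real_normK ?num_real// expr1n; lra.
Qed.

Definition sphere_scale : R := (fine (leb4 (@unit_ball4 R)))^-1.

Lemma sphere_scale_ge0 : 0 <= sphere_scale.
Proof. by rewrite invr_ge0 fine_ge0// leb4_ge0. Qed.

Lemma sphere3_measureE A : sphere3_measure A =
  (sphere_scale%:E * leb4 (punctured_ball `&` normalize @^-1` A))%E.
Proof. by []. Qed.

Let mpre A : measurable A -> measurable (punctured_ball `&` normalize @^-1` A).
Proof.
move=> mA; apply: measurableI; first exact: measurable_punctured_ball.
by rewrite -[X in measurable X]setTI; apply: measurable_normalize.
Qed.

Let sphere3_0 : sphere3_measure (set0 : set (quat R)) = 0%E.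
Proof. by rewrite sphere3_measureE preimage_set0 setI0 leb4E measure0 mule0. Qed.

Let sphere3_ge0 A : (0 <= sphere3_measure A)%E.
Proof. by rewrite sphere3_measureE mule_ge0 ?leb4_ge0// lee_fin sphere_scale_ge0. Qed.

(** Preimages under [normalize] preserve disjoint unions, so additivity is inherited from [mu4] on
    cones. *)
Let sphere3_sigma_additive : semi_sigma_additive (@sphere3_measure R).
Proof.
move=> F mF tF mUF; rewrite sphere3_measureE.
have -> : (fun n => \sum_(0 <= i < n) sphere3_measure (F i))%E =
    (fun n => sphere_scale%:E *
      \sum_(0 <= i < n) mu4 (punctured_ball `&` normalize @^-1` (F i)))%E.
  apply/funext => n; rewrite ge0_sume_distrr => [|i _]; last exact: leb4_ge0.
  by apply: eq_bigr => i _; rewrite sphere3_measureE.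
apply: cvgeZl => //; rewrite preimage_bigcup setI_bigcupr leb4E.
apply: (@measure_semi_sigma_additive _ _ _ mu4
  (fun i => punctured_ball `&` normalize @^-1` (F i))).
- by move=> i; exact: (mpre (mF i)).
- apply/trivIsetP => i j _ _ ij; apply/seteqP; split=> // q [[_ Fi] [_ Fj]].
  move/trivIsetP : tF => /(_ i j Logic.I Logic.I ij) X.
  by have : (F i `&` F j) (normalize q) by []; rewrite X.
- rewrite -setI_bigcupr -preimage_bigcup; exact: mpre.
Qed.

HB.instance Definition _ := isMeasure.Build _ _ _ (@sphere3_measure R)
  sphere3_0 sphere3_ge0 sphere3_sigma_additive.

Let sphere3_fin : fin_num_fun (@sphere3_measure R).
Proof.
move=> A mA; rewrite ge0_fin_numE// sphere3_measureE.
apply: lte_mul_pinfty; rewrite ?lee_fin ?sphere_scale_ge0//.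
(* Every cone lies in the cube of side 2. *)
apply: (@le_lt_trans _ _ (mu4 ((I11 `*` I11) `*` (I11 `*` I11)))).
  apply: (le_measure mu4); rewrite ?inE; first exact: mpre.
    by apply: measurableX; exact: measurableX.
  move=> [[a b] [c e]] [/punctured_ball_box[/= ? ? ? ?] _].
  by do ![split]; rewrite /I11/= in_itv/= -ler_norml.
rewrite [X in (X < _)%E]sfprodX; [|exact: measurableX..].
by rewrite muI11sq -EFinM ltry.
Qed.

HB.instance Definition _ :=
  Measure_isFinite.Build _ _ _ (@sphere3_measure R) sphere3_fin.

End Sphere.

(** * Measure of the set where the real part is near a given value *)

Section Sublevel.
Variable R : realType.
Implicit Types (q x : quat R) (A : set (quat R)).

Let mu : {sigma_finite_measure set (measurableTypeR R) -> \bar R} := @lebesgue_measure R.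

(** With [s], [t] the square roots of [beta], [delta], the product of |a - s| and |a + s| is at most
    t^2, so one factor is at most [t]: this leaves two intervals of length 2t. *)
Lemma lebesgue_measure_sqr_near (A : set (measurableTypeR R)) (beta delta : R) :
  measurable A -> 0 <= delta -> (forall a, A a -> `|a ^+ 2 - beta| <= delta) ->
  (mu A <= (4 * Num.sqrt delta)%:E)%E.
Proof.
move=> mA d0 Ad; pose s := Num.sqrt beta; pose t := Num.sqrt delta.
have t0 : 0 <= t by exact: sqrtr_ge0.
have mI (u : R) : mu `[u - t, u + t]%classic = (2 * t)%:E.
  rewrite /mu/= lebesgue_measure_itv/= lte_fin; case: ifPn => ut.
    by rewrite -EFinB; congr EFin; ring.
  by congr EFin; rewrite -leNgt in ut; lra.
apply: (@le_trans _ _ (mu (`[s - t, s + t]%classic `|` `[- s - t, - s + t]%classic))).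
  apply: le_measure; rewrite ?inE//; first exact: measurableU.
  move=> a /Ad ha; rewrite /= !in_itv/=.
  have as_ : `|a - s| * `|a + s| <= t ^+ 2.
    rewrite -normrM -subr_sqr (sqr_sqrtr d0); have [b0|b0] := leP 0 beta.
      by rewrite (sqr_sqrtr b0).
    (* The square root of a negative [beta] is 0 by convention, and then a^2 <= delta + beta <
       delta. *)
    have -> : s = 0 by exact: ltr0_sqrtr.
    rewrite expr0n subr0 ger0_norm ?sqr_ge0//.
    by move: ha; rewrite ler_norml; lra.
  have [ut|ut] := leP `|a - s| t.
    by left; move: ut; rewrite ler_norml => ?; lra.
  right; suff : `|a + s| <= t by rewrite ler_norml => ?; lra.
  by rewrite leNgt; apply/negP => vt; nra.
have /le_trans -> // : (mu (`[(s - t)%R, (s + t)%R]%classic `|`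
    `[(- s - t)%R, (- s + t)%R]%classic) <= mu `[(s - t)%R, (s + t)%R]%classic + mu `[(- s - t)%R, (- s + t)%R]%classic)%E.
  exact: measureU2.
by rewrite !mI -EFinD lee_fin -/t; lra.
Qed.

Lemma sphere3_measure_re_near (rho e : R) : 0 <= e ->
  (sphere3_measure [set x : quat R | (`|qre x - rho| <= e)%R] <=
   (sphere_scale R * (64 * Num.sqrt e))%:E)%E.
Proof.
move=> e0; rewrite sphere3_measureE EFinM.
set E := _ `&` _.
have mS : measurable [set x : quat R | `|qre x - rho| <= e].
  have -> : [set x : quat R | `|qre x - rho| <= e] =
      (@qre R) @^-1` `[rho - e, rho + e].
    by apply/seteqP; split=> x; rewrite /= in_itv/= ler_distl.
  by rewrite -[X in measurable X]setTI; apply: measurable_qre.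
have mE : measurable E.
  apply: measurableI; first exact: measurable_punctured_ball.
  by rewrite -[X in measurable X]setTI; apply: measurable_normalize.
rewrite lee_wpmul2l ?lee_fin ?sphere_scale_ge0//.
(* The first 8 is the volume of the cube of frozen coordinates; the rest is the two-interval bound
   with [delta] equal to 4e. *)
have -> : 64 * Num.sqrt e = 8 * (8 * Num.sqrt e) by ring.
have s4 : 8 * Num.sqrt e = 4 * Num.sqrt (4 * e).
  by rewrite sqrtrM// (_ : 4 = 2 ^+ 2)  ?sqrtr_sqr ?ger0_norm//; ring.
(* Multiplying the condition on q/|q| by |q| <= 1 keeps the error below [e]. *)
have EQ q : E q -> `|qre q - rho * qnorm q| <= e /\ 0 < qnorm q <= 1.
  move=> [/[dup] qb /andP[q0 q1]]; rewrite /= /normalize /qscale /= => h.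
  split=> //; rewrite (_ : _ - _ = qnorm q * ((qnorm q)^-1 * qre q - rho)).
    rewrite normrM (gtr0_norm q0) (le_trans (ler_piMl _ q1))//.
  by rewrite mulrBr mulVKf ?gt_eqF// mulrC.
(* Multiplication by Re q + rho |q|, of absolute value at most 1 + |rho|, removes the square root
   and gives the quadric. *)
have main q : E q -> `|(1 - rho ^+ 2) * qre q ^+ 2 -
     rho ^+ 2 * (qi q ^+ 2 + qj q ^+ 2 + qk q ^+ 2)| <= e * (1 + `|rho|).
  move=> /[dup] [[/punctured_ball_box[qre1 _ _ _] _]] /EQ[h /andP[q0 q1]].
  have -> : (1 - rho ^+ 2) * qre q ^+ 2 - rho ^+ 2 * (qi q ^+ 2 + qj q ^+ 2 + qk q ^+ 2)
      = (qre q - rho * qnorm q) * (qre q + rho * qnorm q).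
    by rewrite -subr_sqr exprMn sqr_qnorm; ring.
  rewrite normrM ler_pM// (le_trans (ler_normD _ _))// lerD// normrM (gtr0_norm q0).
  by rewrite ler_piMr.
have box q : E q -> [/\ `|qre q| <= 1, `|qi q| <= 1, `|qj q| <= 1 & `|qk q| <= 1].
  by move=> [/punctured_ball_box].
have s0 : 0 <= 8 * Num.sqrt e by rewrite mulr_ge0.
(* For small rho, solve for the square of the real part: dividing by 1 - rho^2 costs at most 4, as 1
   + |rho| <= 4 (1 - rho^2). *)
have [r2|r2] := leP (rho ^+ 2) (2^-1).
- apply: leb4_slice_re_le => // b c f; rewrite s4.
  pose w := b ^+ 2 + c ^+ 2 + f ^+ 2.
  apply: (@lebesgue_measure_sqr_near _ (rho ^+ 2 * w / (1 - rho ^+ 2))).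
  + rewrite -[X in measurable X]setTI.
    apply: (measurable_qmk (a := fun a => a) (b := cst b) (c := cst c) (e := cst f)) => //.
  + by rewrite mulr_ge0.
  move=> a /main/=; rewrite /qmk /qre /qi /qj /qk /= -/w => h.
  have r0 : 0 < 1 - rho ^+ 2 by lra.
  rewrite -(ler_pM2l r0) -[X in X * `|_|](gtr0_norm r0) -normrM.
  rewrite mulrBr [_ * (_ / _)]mulrC divfK ?gt_eqF// (le_trans h)//.
  have : `|rho| ^+ 2 <= 2^-1 by rewrite real_normK ?num_real.
  have -> : rho ^+ 2 = `|rho| ^+ 2 by rewrite real_normK ?num_real.
  have := normr_ge0 rho; move: `|rho| => r rpos r2'.
  have r1 : 1 + r <= (1 - r ^+ 2) * 4 by nra.
  by rewrite [leRHS]mulrA [leRHS]mulrC ler_wpM2l.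
(* Otherwise solve for the square of the k-coordinate; 1 + |rho| <= 4 rho^2 holds even for large
   rho, whence uniformity. *)
- apply: leb4_slice_k_le => // a b c; rewrite s4.
  pose w := (1 - rho ^+ 2) * a ^+ 2 - rho ^+ 2 * (b ^+ 2 + c ^+ 2).
  apply: (@lebesgue_measure_sqr_near _ (w / rho ^+ 2)).
  + rewrite -[X in measurable X]setTI.
    apply: (measurable_qmk (a := cst a) (b := cst b) (c := cst c) (e := fun a => a)) => //.
  + by rewrite mulr_ge0.
  move=> f /main/=; rewrite /qmk /qre /qi /qj /qk /= distrC => h.
  have r0 : 0 < rho ^+ 2 by lra.
  rewrite -(ler_pM2l r0) -[X in X * `|_|](gtr0_norm r0) -normrM.
  rewrite mulrBr [_ * (_ / _)]mulrC divfK ?gt_eqF//.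
  apply: le_trans (_ : e * (1 + `|rho|) <= _).
    apply: le_trans h; rewrite le_eqVlt; apply/orP; left.
    by apply/eqP; congr `|_|; rewrite /w; ring.
  have : 2^-1 < `|rho| ^+ 2 by rewrite real_normK ?num_real.
  have -> : rho ^+ 2 = `|rho| ^+ 2 by rewrite real_normK ?num_real.
  have := normr_ge0 rho; move: `|rho| => r rpos r2'.
  have r1 : 2^-1 <= r by nra.
  have r3 : 1 + r <= r ^+ 2 * 4 by nra.
  by rewrite [leRHS]mulrA [leRHS]mulrC ler_wpM2l.
Qed.

End Sublevel.

(** * The negative part of the logarithm *)

Section NegativeLog.
Variable R : realType.
Implicit Types u v : R.
Local Open Scope ereal_scope.

(** The value +oo is also taken at negative arguments, which makes the function nonincreasing on the
    whole line. *)
Definition nlog u : \bar R := if (u <= 0)%R then +oo else (Num.max 0 (- ln u)%R)%:E.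

Lemma nlog_ge0 u : 0 <= nlog u.
Proof. by rewrite /nlog; case: ifPn => // _; rewrite lee_fin le_max lexx. Qed.

Lemma nlog_lty u : (0 < u)%R -> nlog u < +oo.
Proof. by move=> u0; rewrite /nlog leNgt u0 ltry. Qed.

Lemma le_nlog u v : (u <= v)%R -> nlog v <= nlog u.
Proof.
move=> uv; rewrite /nlog; case: ifPn => [v0|]; first by rewrite (le_trans uv v0).
rewrite -ltNge => v0; case: ifPn => [_|]; first by rewrite leey.
rewrite -ltNge => u0; rewrite lee_fin ge_max le_max lexx/= le_max lerN2.
by rewrite ler_ln ?posrE// uv orbT.
Qed.

Lemma nlogM u v : (0 <= u)%R -> (0 <= v)%R -> nlog (u * v)%R <= nlog u + nlog v.
Proof.
rewrite le_eqVlt => /predU1P[<- _|u0].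
  by rewrite mul0r {2}/nlog lexx addye ?leey// gt_eqF// (lt_le_trans _ (nlog_ge0 v))// ltNy0.
rewrite le_eqVlt => /predU1P[<-|v0].
  by rewrite mulr0 {3}/nlog lexx addey ?leey// gt_eqF// (lt_le_trans _ (nlog_ge0 u))// ltNy0.
rewrite /nlog [(u <= 0)%R]leNgt u0 [(v <= 0)%R]leNgt v0.
rewrite [(u * v <= 0)%R]leNgt mulr_gt0//= lee_fin lnM ?posrE// ge_max.
rewrite addr_ge0 ?le_max ?lexx//= opprD lerD// le_max lexx orbT//.
Qed.

Lemma nlog_prod (s : seq R) (f : R -> R) : (forall r, (0 <= f r)%R) ->
  nlog (\prod_(r <- s) f r)%R <= \sum_(r <- s) nlog (f r).
Proof.
move=> f0; elim: s => [|r s ih].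
  by rewrite !big_nil /nlog ln1 oppr0 maxxx ler10.
rewrite !big_cons (le_trans (nlogM _ _))//; first by rewrite prodr_ge0.
by rewrite leeD2l.
Qed.

Lemma measurable_nlog : measurable_fun setT nlog.
Proof.
apply: measurable_fun_ifT.
- by apply: measurable_fun_ler => //; exact: measurable_cst.
- exact: measurable_cst.
- apply/measurable_EFinP; apply: measurable_maxr; first exact: measurable_cst.
  by apply: measurableT_comp => //; exact: measurable_ln.
Qed.

(* Layer cake: the number of k with u <= e^-k is at least -ln u. *)
Lemma nlog_le_series u :
  nlog u <= \sum_(0 <= k <oo) (\1_[set v | (v <= expR (- k%:R))%R] u)%:E.
Proof.
set S := (X in _ <= X).
have S_ge n : (forall k, (k < n)%N -> (u <= expR (- k%:R))%R) -> n%:R%:E <= S.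
  move=> un; apply: (@le_trans _ _
    (\sum_(0 <= k < n) (\1_[set v | (v <= expR (- k%:R))%R] u)%:E)).
    rewrite big_mkord (eq_bigr (fun=> 1%:E)) => [|k _].
      by rewrite sumEFin sumr_const card_ord.
    by rewrite indicE mem_set//=; exact: un.
  by apply: nneseries_lim_ge => k _ _; rewrite lee_fin.
(* For u <= 0 every index counts, so the series exceeds every real. *)
rewrite /nlog; case: ifPn => [u0|].
  rewrite leye_eq; apply/eqP; apply/eqyP => r r0.
  apply: (@le_trans _ _ (Num.truncn r).+1%:R%:E).
    by rewrite lee_fin ltW// truncnS_gt.
  by apply: S_ge => k _; rewrite (le_trans u0)// expR_ge0.
rewrite -ltNge => u0; have [l0|l0] := leP 0%R (- ln u)%R; last first.
  by apply: nneseries_ge0 => k _ _; rewrite lee_fin.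
(* The indices from 0 to the integer part of -ln u count, one more than that integer part, hence
   more than -ln u. *)
apply: (@le_trans _ _ (Num.truncn (- ln u)).+1%:R%:E).
  by rewrite lee_fin ltW// truncnS_gt.
apply: S_ge => k; rewrite ltnS => kl; rewrite -[leLHS](lnK)// ler_expR lerNr.
apply: (@le_trans _ _ (Num.truncn (- ln u))%:R); first by rewrite ler_nat.
by rewrite truncn_le.
Qed.

End NegativeLog.

(** * Integrability of log^- |Re x - rho|, uniformly in rho *)

Section SphereNlog.
Variable R : realType.
Local Open Scope ereal_scope.

Definition sphere3 : set (quat R) := [set x | qnorm x = 1%R].

Lemma measurable_sphere3 : measurable sphere3.
Proof.
have -> : sphere3 = (@qnorm R) @^-1` [set 1%R] by [].
by rewrite -[X in measurable X]setTI; apply: measurable_qnorm.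
Qed.

(** The sum over k of the sublevel bounds at e = exp(-k), a geometric series of ratio exp(-1/2). *)
Definition re_nlog_bound : R :=
  sphere_scale R * 64 / (1 - expR (- 2^-1)).

(** Integrate the layer-cake series termwise; each term is the measure of a sublevel set, bounded
    independently of [rho]. *)
Lemma integral_nlog_re_le (rho : R) :
  \int[@sphere3_measure R]_(x in sphere3) nlog `|qre x - rho|%R <= re_nlog_bound%:E.
Proof.
pose A (k : nat) := [set x : quat R | (`|qre x - rho| <= expR (- k%:R))%R].
have mre : measurable_fun [set: quat R] (fun x : quat R => `|qre x - rho|)%R.
  apply: measurableT_comp => //; apply: measurable_funB; last exact: measurable_cst.
  exact: measurable_qre.
have mA k : measurable (A k).
  rewrite (_ : A k = (fun x : quat R => `|qre x - rho|%R) @^-1` [set` `]-oo, expR (- k%:R)%R]%R]).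
    by rewrite -[X in measurable X]setTI; apply: mre.
  by apply/seteqP; split=> x; rewrite /= in_itv.
apply: (@le_trans _ _ (\int[@sphere3_measure R]_(x in sphere3)
    \sum_(0 <= k <oo) (\1_(A k) x)%:E)).
  apply: ge0_le_integral.
  - exact: measurable_sphere3.
  - by move=> x _; exact: nlog_ge0.
  - apply: measurable_funTS; apply: (measurableT_comp (f := @nlog R)) => //.
    exact: measurable_nlog.
  - apply: ge0_emeasurable_sum => k; first by move=> *; rewrite lee_fin.
    by move=> _; apply/measurable_EFinP; exact: measurable_indic.
  - by move=> x _; exact: nlog_le_series.
rewrite integral_nneseries.
- apply: lime_le; first by apply: is_cvg_nneseries => k _ _; exact: integral_ge0.
  apply: nearW => n; pose q := expR (- 2^-1) : R.
  have q0 : (0 < q)%R by exact: expR_gt0.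
  have q1 : (q < 1)%R by rewrite expR_lt1 oppr_lt0 invr_gt0.
  apply: (@le_trans _ _ (\sum_(0 <= k < n) (sphere_scale R * 64 * q ^+ k)%R%:E)).
    apply: lee_sum => k _; rewrite integral_indic//; last exact: measurable_sphere3.
    apply: (@le_trans _ _ (sphere3_measure (A k))).
      apply: le_measure; rewrite ?inE//.
      by apply: measurableI => //; exact: measurable_sphere3.
    rewrite (le_trans (sphere3_measure_re_near _ _)) ?expR_ge0// lee_fin mulrA.
    rewrite ler_wpM2l ?mulr_ge0 ?sphere_scale_ge0//.
    (* Halving the exponent exhibits exp(-k) as a square, so its root is [q ^+ k]. *)
    rewrite -expRM_natl (_ : - k%:R = k%:R * - 2^-1 + k%:R * - 2^-1)%R; last by lra.
    by rewrite expRD -expr2 sqrtr_sqr ger0_norm ?expR_ge0// mulr_natl.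
  rewrite sumEFin lee_fin -mulr_sumr /re_nlog_bound ler_wpM2l ?mulr_ge0 ?sphere_scale_ge0//.
  have qn : ((1 - q) * \sum_(0 <= k < n) q ^+ k = 1 - q ^+ n)%R.
    by rewrite big_mkord -opprB mulNr -subrX1 opprB.
  rewrite -[leRHS]mul1r ler_pdivlMr ?subr_gt0// mulrC qn.
  by rewrite gerBl exprn_ge0// ltW.
- exact: measurable_sphere3.
- by move=> k; apply/measurable_EFinP; exact: measurable_indic.
- by move=> k x _; rewrite lee_fin.
Qed.

End SphereNlog.

(** * Quaternion algebra, symmetrization and complex slices *)

Section QuaternionAlgebra.
Variable R : realType.
Implicit Types (p q x y : quat R) (b : nat -> quat R).

(** Turns big sums over [qadd] into sums in the additive group that the pair type already
    carries. *)
Lemma qaddE : @qadd R = +%R.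
Proof. by apply/funext => -[[? ?] [? ?]]; apply/funext => -[[? ?] [? ?]]. Qed.

Ltac quat_ring :=
  rewrite /qmul /qscale /qmk /qre /qi /qj /qk; do ?[congr pair]; rewrite /=; ring.

Lemma qmulA p q x : qmul p (qmul q x) = qmul (qmul p q) x.
Proof. quat_ring. Qed.
Lemma qmulDl p q x : qmul (p + q) x = qmul p x + qmul q x.
Proof. quat_ring. Qed.
Lemma qmulDr p q x : qmul p (q + x) = qmul p q + qmul p x.
Proof. quat_ring. Qed.
Lemma q1mul q : qmul q (@qone R) = q.
Proof. move: q => [[? ?] [? ?]]; quat_ring. Qed.
Lemma qmul0 q : qmul q 0 = 0.
Proof. quat_ring. Qed.
Lemma q0mul q : qmul 0 q = 0.
Proof. quat_ring. Qed.

Lemma qmul_suml I (r : seq I) (P : pred I) (F : I -> quat R) q :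
  qmul (\sum_(i <- r | P i) F i) q = \sum_(i <- r | P i) qmul (F i) q.
Proof. exact: (big_morph (fun p => qmul p q) (fun p x => qmulDl p x q) (q0mul q)). Qed.

Lemma qmul_sumr I (r : seq I) (P : pred I) (F : I -> quat R) q :
  qmul q (\sum_(i <- r | P i) F i) = \sum_(i <- r | P i) qmul q (F i).
Proof. exact: (big_morph (qmul q) (qmulDr q) (qmul0 q)). Qed.

Lemma qexpD x m n : qexp x (m + n) = qmul (qexp x m) (qexp x n).
Proof. by elim: n => [|n ih]; rewrite ?addn0 ?q1mul// addnS /= ih qmulA. Qed.

(** Euler's four-square identity. *)
Lemma qnormM p q : qnorm (qmul p q) = qnorm p * qnorm q.
Proof.
rewrite /qnorm -sqrtrM ?addr_ge0 ?sqr_ge0//; congr Num.sqrt.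
rewrite /qmul /qmk /qre /qi /qj /qk /=; ring.
Qed.

Lemma qnorm0 : qnorm (0 : quat R) = 0.
Proof. by rewrite /qnorm /qre /qi /qj /qk /= expr0n !addr0 sqrtr0. Qed.

Lemma qnorm1 : qnorm (@qone R) = 1.
Proof. by rewrite /qnorm /qre /qi /qj /qk /= expr0n expr1n !addr0 sqrtr1. Qed.

Lemma qnorm_eq0 q : (qnorm q == 0) = (q == 0).
Proof.
apply/eqP/eqP => [q0|->]; last exact: qnorm0.
have := sqr_qnorm q; rewrite q0 expr0n/= => /esym/eqP.
rewrite !paddr_eq0 ?addr_ge0 ?sqr_ge0// !sqrf_eq0.
by move: q {q0} => [[a b] [c e]]; rewrite /qre /qi /qj /qk /= =>
  /andP[/andP[/andP[/eqP-> /eqP->] /eqP->] /eqP->].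
Qed.

Lemma qnormX x n : qnorm x = 1 -> qnorm (qexp x n) = 1.
Proof. by move=> x1; elim: n => [|n ih]/=; rewrite ?qnorm1// qnormM ih x1 mulr1. Qed.

Definition qdot p q := qre p * qre q + qi p * qi q + qj p * qj q + qk p * qk q.

(** Cauchy-Schwarz by Lagrange's identity: the defect is the sum of the squares of the six 2x2
    minors. *)
Lemma qdot_le p q : qdot p q <= qnorm p * qnorm q.
Proof.
have [pq|pq] := leP 0 (qdot p q); last first.
  by rewrite (le_trans (ltW pq))// mulr_ge0 ?qnorm_ge0.
rewrite -(@ler_pXn2r _ 2) ?nnegrE ?mulr_ge0 ?qnorm_ge0// exprMn !sqr_qnorm.
pose P1 := (qre p * qi q - qi p * qre q) ^+ 2; pose P2 := (qre p * qj q - qj p * qre q) ^+ 2.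
pose P3 := (qre p * qk q - qk p * qre q) ^+ 2; pose P4 := (qi p * qj q - qj p * qi q) ^+ 2.
pose P5 := (qi p * qk q - qk p * qi q) ^+ 2; pose P6 := (qj p * qk q - qk p * qj q) ^+ 2.
rewrite -subr_ge0 (_ : _ - _ = P1 + P2 + P3 + P4 + P5 + P6); last first.
  by rewrite /qdot /P1 /P2 /P3 /P4 /P5 /P6; ring.
by rewrite !addr_ge0// sqr_ge0.
Qed.

Lemma qnormD p q : qnorm (p + q) <= qnorm p + qnorm q.
Proof.
rewrite -(@ler_pXn2r _ 2) ?nnegrE ?addr_ge0 ?qnorm_ge0// sqrrD !sqr_qnorm.
have := qdot_le p q; rewrite /qdot /qre /qi /qj /qk /=; lra.
Qed.

Lemma qnorm_sum I (r : seq I) (P : pred I) (F : I -> quat R) :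
  qnorm (\sum_(i <- r | P i) F i) <= \sum_(i <- r | P i) qnorm (F i).
Proof.
elim/big_ind2: _ => [|p u q v pu qv|//]; first by rewrite qnorm0.
by rewrite (le_trans (qnormD _ _))// lerD.
Qed.

Definition qconj q := qmk (qre q) (- qi q) (- qj q) (- qk q).

Lemma qnorm_conj q : qnorm (qconj q) = qnorm q.
Proof. by rewrite /qnorm /qre /qi /qj /qk /= !sqrrN. Qed.

(** The two terms are conjugate to each other; this is the source of the real coefficients of
    [qsym]. *)
Lemma qmul_conj_sym p q :
  qmul p (qconj q) + qmul q (qconj p) = qmk (2 * qdot p q) 0 0 0.
Proof. rewrite /qconj /qdot; quat_ring. Qed.

Definition rightpoly (d : nat) b x := \sum_(l < d.+1) qmul (qexp x l) (b l).

Lemma qnorm_rightpoly_le d b x : qnorm x = 1 ->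
  qnorm (rightpoly d b x) <= \sum_(l < d.+1) qnorm (b l).
Proof.
move=> x1; rewrite (le_trans (qnorm_sum _ _ _))//; apply: ler_sum => l _.
by rewrite qnormM qnormX// mul1r.
Qed.

(** The polynomial F, known in slice regular function theory as the symmetrization: the star product
    of p with its conjugate. *)
Definition qsym (d : nat) b x : quat R :=
  \sum_(l < d.+1) \sum_(m < d.+1) qmul (qexp x (l + m)) (qmk (qdot (b l) (b m)) 0 0 0).

(** Powers of x commute, so the left side is [S]. Exchanging l and m conjugates its coefficients, so
    in [S + S] they add up to twice their real parts; then halve. *)
Lemma qsymE d b x :
  \sum_(m < d.+1) qmul (qexp x m) (qmul (rightpoly d b x) (qconj (b m))) = qsym d b x.
Proof.
pose S := \sum_(l < d.+1) \sum_(m < d.+1)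
  qmul (qexp x (l + m)) (qmul (b l) (qconj (b m))).
have -> : \sum_(m < d.+1) qmul (qexp x m) (qmul (rightpoly d b x) (qconj (b m))) = S.
  rewrite /S exchange_big; apply: eq_bigr => m _.
  rewrite qmul_suml qmul_sumr; apply: eq_bigr => l _.
  by rewrite addnC qexpD -!qmulA.
have SS : S + S = qsym d b x + qsym d b x.
  rewrite {1}/S exchange_big /S -!big_split; apply: eq_bigr => l _.
  rewrite -!big_split; apply: eq_bigr => m _ /=.
  rewrite addnC -!qmulDr addrC qmul_conj_sym.
  congr qmul; rewrite /qmk; do ?[congr pair] => /=; ring.
have half (a c : R) : a + a = c + c -> a = c by lra.
move: SS; case: S => [[a1 a2] [a3 a4]]; case: (qsym _ _ _) => [[c1 c2] [c3 c4]].
by case=> /half-> /half-> /half-> /half->.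
Qed.

Lemma qnorm_qsym_le d b x : qnorm x = 1 ->
  qnorm (qsym d b x) <= (\sum_(m < d.+1) qnorm (b m)) * qnorm (rightpoly d b x).
Proof.
move=> x1; rewrite -qsymE (le_trans (qnorm_sum _ _ _))// mulr_suml.
apply: ler_sum => m _; rewrite qnormM qnormX// mul1r qnormM qnorm_conj mulrC//.
Qed.

Section Slice.
Variables (e1 e2 e3 : R) (e_unit : e1 ^+ 2 + e2 ^+ 2 + e3 ^+ 2 = 1).
Local Open Scope complex_scope.

Definition slice (z : R[i]) : quat R :=
  qmk (complex.Re z) (complex.Im z * e1) (complex.Im z * e2) (complex.Im z * e3).

Lemma sliceD (z w : R[i]) : slice (z + w) = slice z + slice w.
Proof. by case: z w => [? ?] [? ?]; rewrite /slice /= !mulrDl. Qed.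

Lemma slice0 : slice 0 = 0.
Proof. by rewrite /slice /= !mul0r. Qed.

Lemma sliceM (z w : R[i]) : slice (z * w) = qmul (slice z) (slice w).
Proof.
case: z w => [a c] [a' c']; rewrite /slice /qmul /qmk /qre /qi /qj /qk /=.
congr ((_, _), (_, _)); try ring.
have -> : a * a' - c * c' = a * a' - c * c' * (e1 ^+ 2 + e2 ^+ 2 + e3 ^+ 2).
  by rewrite e_unit mulr1.
ring.
Qed.

Lemma sliceX (z : R[i]) n : slice (z ^+ n) = qexp (slice z) n.
Proof.
elim: n => [|n ih]; first by rewrite /slice expr0 /= !mul0r.
by rewrite exprSr sliceM ih.
Qed.

Lemma slice_real (a : R) : slice (a%:C) = qmk a 0 0 0.
Proof. by rewrite /slice /= !mul0r. Qed.

Lemma slice_sum I (r : seq I) (F : I -> R[i]) :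
  slice (\sum_(i <- r) F i) = \sum_(i <- r) slice (F i).
Proof. exact: (big_morph slice sliceD slice0). Qed.

Lemma qnorm_slice (z : R[i]) : qnorm (slice z) = Normc.normc z.
Proof.
case: z => a c; rewrite /qnorm /slice /qre /qi /qj /qk /=; congr Num.sqrt.
by rewrite -[in RHS](mulr1 (c ^+ 2)) -e_unit; ring.
Qed.

End Slice.

Lemma slice_ex x : exists e1 e2 e3 (z : R[i]),
  [/\ e1 ^+ 2 + e2 ^+ 2 + e3 ^+ 2 = 1, complex.Re z = qre x & x = slice e1 e2 e3 z].
Proof.
move: x => [[a b1] [b2 b3]].
pose s := Num.sqrt (b1 ^+ 2 + b2 ^+ 2 + b3 ^+ 2).
have s2 : s ^+ 2 = b1 ^+ 2 + b2 ^+ 2 + b3 ^+ 2 by rewrite sqr_sqrtr// !addr_ge0// sqr_ge0.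
have [s0|s0] := eqVneq s 0.
  (* A real quaternion lies in every slice; the one through i is taken. *)
  exists 1, 0, 0, (a%:C)%C; split=> //; first by rewrite expr1n expr0n !addr0.
  move: s2; rewrite s0 expr0n => /esym/eqP.
  rewrite !paddr_eq0 ?addr_ge0 ?sqr_ge0// !sqrf_eq0.
  by move=> /andP[/andP[/eqP-> /eqP->] /eqP->]; rewrite /slice /= !mul0r.
exists (b1 / s), (b2 / s), (b3 / s), (a +i* s)%C; split=> //.
  by rewrite !expr_div_n -!mulrDl -s2 divff// sqrf_eq0.
by rewrite /slice /qmk /= ![s * _]mulrC !divfK.
Qed.

End QuaternionAlgebra.

(** * Lower bound for a one-variable polynomial on the sphere *)

Section LowerBound.
Variable R : realType.
Implicit Types (x : quat R) (b : nat -> quat R).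

(** [s] lists the real parts of the complex roots: each linear factor is at least the distance
    between real parts. *)
Lemma normc_horner_ge (G : {poly R[i]}) : G != 0 ->
  exists2 s : seq R, (size s).+1 = size G &
    forall z, Normc.normc (lead_coef G) * \prod_(r <- s) `|complex.Re z - r| <=
      Normc.normc G.[z].
Proof.
move=> G0; have [t Gt] := closed_field_poly_normal G.
exists (map (@complex.Re R) t).
  rewrite size_map {1}Gt size_scale ?lead_coef_eq0//.
  by rewrite size_prod_XsubC.
move=> z; rewrite {2}Gt hornerZ Normc.normcM ler_wpM2l ?sqrtr_ge0//.
  by case: (lead_coef G) => u v; exact: sqrtr_ge0.
rewrite horner_prod big_map.
set A := \prod_(_ <- _) _; set B := \prod_(_ <- _) _.
suff /andP[] : 0 <= A <= Normc.normc B by [].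
rewrite /A /B; elim/big_rec2: _ => [|w u v _ /andP[v0 uv]].
  by rewrite Normc.normc1 ler01 lexx.
rewrite mulr_ge0//= Normc.normcM ler_pM//.
rewrite hornerXsubC; clear A B uv; case: z w => [z1 z2] [w1 w2] /=.
rewrite -sqrtr_sqr ler_wsqrtr//.
by rewrite lerDl sqr_ge0.
Qed.

Definition sym_poly d b : {poly R[i]} := \sum_(l < d.+1) \sum_(m < d.+1)
  ((qdot (b l) (b m))%:C)%C *: 'X^(l + m).

(** Real coefficients lie in every slice, so a single complex polynomial computes [qsym] on all
    slices at once. *)
Lemma slice_sym_poly e1 e2 e3 d b (z : R[i]) :
  e1 ^+ 2 + e2 ^+ 2 + e3 ^+ 2 = 1 ->
  slice e1 e2 e3 (sym_poly d b).[z] = qsym d b (slice e1 e2 e3 z).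
Proof.
move=> e_unit; rewrite /sym_poly horner_sum slice_sum; apply: eq_bigr => l _.
rewrite horner_sum slice_sum; apply: eq_bigr => m _.
by rewrite hornerZ hornerXn mulrC sliceM// sliceX// slice_real.
Qed.

Lemma size_sym_poly d b : (size (sym_poly d b) <= (d + d).+1)%N.
Proof.
apply: (leq_trans (size_sum _ _ _)); apply/bigmax_leqP => l _.
apply: (leq_trans (size_sum _ _ _)); apply/bigmax_leqP => m _.
rewrite (leq_trans (size_scale_leq _ _))// size_polyXn ltnS.
by apply: leq_add; rewrite -ltnS.
Qed.

Lemma coef_sym_poly d b : (sym_poly d b)`_(d + d) = ((qnorm (b d) ^+ 2)%:C)%C.
Proof.
have -> : qnorm (b d) ^+ 2 = qdot (b d) (b d) by rewrite sqr_qnorm /qdot; ring.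
rewrite coef_sum (bigD1 ord_max)//= coef_sum (bigD1 ord_max)//=.
rewrite coefZ coefXn eqxx mulr1 !big1 ?addr0// => [l|m]; rewrite -val_eqE/= => ld.
  rewrite coef_sum big1// => m _; rewrite coefZ coefXn.
  case: eqP => [E|]; last by rewrite mulr0.
  by have := ltn_ord l; have := ltn_ord m; rewrite !ltnS => ? ?; move/eqP: ld; lia.
rewrite coefZ coefXn; case: eqP => [E|]; last by rewrite mulr0.
by move/eqP: ld; lia.
Qed.

(** One list [s] serves every x because the complex polynomial is the same on all slices; the
    nonzero coefficient |b_d|^2 in degree 2d fixes its length. *)
Lemma qnorm_rightpoly_ge d b : b d != 0 ->
  exists2 s : seq R, size s = (d + d)%N &
    forall x, qnorm x = 1 ->
      qnorm (b d) ^+ 2 * \prod_(r <- s) `|qre x - r| <=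
      (\sum_(m < d.+1) qnorm (b m)) * qnorm (rightpoly d b x).
Proof.
move=> bd0; pose G := sym_poly d b.
have c0 : (sym_poly d b)`_(d + d) != 0.
  by rewrite coef_sym_poly; apply/eqP => -[/eqP]; rewrite sqrf_eq0 qnorm_eq0 (negPf bd0).
have sG : size G = (d + d).+1.
  apply/eqP; rewrite eqn_leq size_sym_poly/= ltnNge; apply/negP => dG.
  by move/eqP : c0; apply; rewrite nth_default.
have G0 : G != 0 by rewrite -size_poly_gt0 sG.
have [s sE sG_ge] := normc_horner_ge G0; exists s; first by move: sE; rewrite sG => -[].
move=> x x1; apply: (le_trans _ (qnorm_qsym_le d b x1)).
have [e1 [e2 [e3 [z [e_unit rez xE]]]]] := slice_ex x.
rewrite xE -slice_sym_poly// qnorm_slice// -xE.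
apply: le_trans (sG_ge z); rewrite rez /lead_coef sG/= coef_sym_poly /=.
by rewrite expr0n addr0 sqrtr_sqr ger0_norm ?sqr_ge0.
Qed.

End LowerBound.

(** * Integral of log^- |p| in one variable *)

Section LogIntegrability.
Variable R : realType.
Implicit Types (x y : quat R) (b : nat -> quat R).
Local Open Scope ereal_scope.

Let sigma : {finite_measure set (quat R) -> \bar R} := @sphere3_measure R.
Let mass : R := fine (sigma (@sphere3 R)).

Let sigma_sphere3 : sigma (@sphere3 R) = mass%:E.
Proof. by rewrite fineK// fin_num_measure//; exact: measurable_sphere3. Qed.

Let mass_ge0 : (0 <= mass)%R.
Proof. exact: fine_ge0. Qed.

Let mS : measurable (@sphere3 R) := @measurable_sphere3 R.

Lemma re_nlog_bound_ge0 : (0 <= re_nlog_bound R)%R.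
Proof.
rewrite -lee_fin (le_trans _ (integral_nlog_re_le 0))//.
by apply: integral_ge0 => x _; exact: nlog_ge0.
Qed.

Lemma measurable_nlog_comp d (T : measurableType d) (f : T -> R) :
  measurable_fun setT f -> measurable_fun setT (fun t => nlog (f t)).
Proof.
by move=> mf; apply: (measurableT_comp (f := @nlog R)) => //; exact: measurable_nlog.
Qed.

Lemma measurable_rightpoly d b : measurable_fun setT (rightpoly d b).
Proof.
apply: measurable_qsum => l; apply: measurable_qmul; last exact: measurable_cst.
by apply: measurable_qexp; exact: measurable_id.
Qed.

(** [K] is chosen before [b], so that in two variables one constant covers all the polynomials P(.,
    y). *)
Lemma integral_nlog_rightpoly_le (d : nat) (C : R) : (1 <= C)%R ->
  exists2 K : R, (0 < K)%R & forall b, (\sum_(m < d.+1) qnorm (b m) <= C)%R ->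
    \int[@sphere3_measure R]_(x in @sphere3 R) nlog (qnorm (rightpoly d b x)) <=
    K%:E + K%:E * nlog (qnorm (b d)).
Proof.
move=> C1; have C0 : (0 < C)%R by exact: lt_le_trans C1.
pose kc := ln C; have kc0 : (0 <= kc)%R by exact: ln_ge0.
have nlogC : nlog C^-1 = kc%:E.
  by rewrite /nlog leNgt invr_gt0 C0/= lnV ?posrE// opprK max_r.
pose N := ((d + d)%:R * re_nlog_bound R)%R.
have N0 : (0 <= N)%R by rewrite mulr_ge0 ?re_nlog_bound_ge0.
(* [2 * mass] pays for the factor |b_d|^2, [N] for the 2d roots and [kc * mass] for [C]; the 1 makes
   [K] positive, so that [K] times +oo is +oo. *)
pose K := (1 + 2 * mass + N + kc * mass)%R.
have K0 : (0 < K)%R by rewrite /K -!addrA ltr_pwDl// !addr_ge0// mulr_ge0.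
exists K => // b bC.
have [bd0|bd0] := eqVneq (b d) 0%R.
  by rewrite bd0 qnorm0 /nlog lexx gt0_muley// addey// leey.
have nb0 : (0 < qnorm (b d))%R by rewrite lt_def qnorm_eq0 bd0 qnorm_ge0.
pose nb := fine (nlog (qnorm (b d))).
have nbE : nlog (qnorm (b d)) = nb%:E by rewrite fineK// ge0_fin_numE ?nlog_ge0// nlog_lty.
have nb_ge0 : (0 <= nb)%R by rewrite -lee_fin -nbE nlog_ge0.
have [s sE s_ge] := qnorm_rightpoly_ge bd0.
have mre r : measurable_fun setT (fun x : quat R => nlog `|qre x - r|%R).
  apply: measurable_nlog_comp; apply: measurableT_comp => //.
  by apply: measurable_funB; [exact: measurable_qre|exact: measurable_cst].
apply: (@le_trans _ _ (\int[@sphere3_measure R]_(x in @sphere3 R)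
    ((kc + 2 * nb)%:E + \sum_(r <- s) nlog `|qre x - r|%R))).
  apply: ge0_le_integral => //.
  - by move=> x _; exact: nlog_ge0.
  - apply: measurable_funTS; apply: measurable_nlog_comp; apply: measurable_qnorm.
    exact: measurable_rightpoly.
  - apply: measurable_funTS; apply: emeasurable_funD; first exact: measurable_cst.
    exact: emeasurable_sum.
  move=> x x1; have {}s_ge := s_ge x x1.
  set W := (\prod_(r <- s) _)%R in s_ge.
  have W0 : (0 <= W)%R by rewrite prodr_ge0.
  (* The lower bound reads |p(x)| >= |b_d|^2 W / C; subadditivity of [nlog] then splits the
     factors. *)
  apply: (@le_trans _ _ (nlog (C^-1 * (qnorm (b d) * (qnorm (b d) * W)))%R)).
    apply: le_nlog; rewrite mulrC ler_pdivrMr// mulrA -expr2 (le_trans s_ge)// mulrC.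
    by rewrite ler_wpM2l// qnorm_ge0.
  have q0 := qnorm_ge0 (b d).
  apply: (le_trans (nlogM _ _)); rewrite ?invr_ge0 ?(ltW C0)//; first by rewrite !mulr_ge0.
  rewrite nlogC EFinD -addeA leeD2l//.
  apply: (le_trans (nlogM _ _)) => //; first by rewrite mulr_ge0.
  rewrite mulr2n mulrDl mul1r EFinD -addeA nbE leeD2l//.
  apply: (le_trans (nlogM _ _)) => //; rewrite nbE leeD2l//.
  exact: nlog_prod.
rewrite ge0_integralD//; last 3 first.
- by move=> x _; rewrite lee_fin addr_ge0// mulr_ge0.
- by move=> x _; apply: sume_ge0 => r _; exact: nlog_ge0.
- by apply: measurable_funTS; exact: emeasurable_sum.
rewrite [X in X + _](_ : _ = ((kc + 2 * nb) * mass)%:E); last first.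
  by rewrite integral_cst// EFinM -sigma_sphere3.
rewrite ge0_integral_sum//; last 2 first.
- by move=> r; exact: measurable_funTS.
- by move=> r x _; exact: nlog_ge0.
apply: (@le_trans _ _ (((kc + 2 * nb) * mass)%:E + N%:E)).
  rewrite leeD2l// /N -sE.
  elim: (s) => [|r t ih]; first by rewrite big_nil mul0r.
  rewrite big_cons/= -[(size t).+1]add1n natrD mulrDl mul1r EFinD leeD//.
  exact: integral_nlog_re_le.
rewrite nbE -EFinM -!EFinD lee_fin /K.
have : (0 <= nb * N)%R by rewrite mulr_ge0.
have : (0 <= kc * mass)%R by rewrite mulr_ge0.
have : (0 <= nb * (kc * mass))%R by rewrite !mulr_ge0.
move: nb_ge0 mass_ge0 N0; move: (mass) (nb) (N) (kc) => m u v w.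
nra.
Qed.

Lemma integral_nlog_rightpoly_lty (d : nat) b : b d != 0%R ->
  \int[@sphere3_measure R]_(x in @sphere3 R) nlog (qnorm (rightpoly d b x)) < +oo.
Proof.
move=> bd0.
have s0 : (0 <= \sum_(m < d.+1) qnorm (b m))%R by rewrite sumr_ge0// => *; exact: qnorm_ge0.
have [|K K0 /(_ b)] := @integral_nlog_rightpoly_le d (1 + \sum_(m < d.+1) qnorm (b m)).
  by rewrite lerDl.
rewrite lerDr => /(_ ler01) /le_lt_trans -> //.
rewrite lte_add_pinfty ?ltry// lte_mul_pinfty ?lee_fin ?(ltW K0)// nlog_lty//.
by rewrite lt_def qnorm_eq0 bd0 qnorm_ge0.
Qed.

End LogIntegrability.

(** * Tonelli on the torus and the polynomial in two variables *)

Section TwoVariables.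
Variable R : realType.
Implicit Types (x y : quat R) (a : nat -> nat -> quat R).
Local Open Scope ereal_scope.

Lemma measurable_torus2H : measurable (@torus2H R).
Proof.
have -> : @torus2H R = @sphere3 R `*` @sphere3 R by [].
by apply: measurableX; exact: measurable_sphere3.
Qed.

Lemma haarT2_torus_lty : haarT2 (@torus2H R) < +oo.
Proof.
rewrite (_ : @haarT2 R = sfprod (@sphere3_measure R) (@sphere3_measure R))//.
rewrite (_ : @torus2H R = @sphere3 R `*` @sphere3 R)//.
rewrite sfprodX; [|exact: measurable_sphere3..].
by rewrite lte_mul_pinfty// -?ge0_fin_numE// fin_num_measure//; exact: measurable_sphere3.
Qed.

(** Tonelli with x innermost, for functions extended by zero: the section of the torus at y is the
    sphere if y is on it and empty otherwise. *)
Lemma integral_torus2H_le (g : quat R * quat R -> \bar R) (h : quat R -> \bar R) :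
  measurable_fun setT g -> (forall p, 0 <= g p) ->
  measurable_fun setT h -> (forall y, 0 <= h y) ->
  (forall y, @sphere3 R y ->
    \int[@sphere3_measure R]_(x in @sphere3 R) g (x, y) <= h y) ->
  \int[@haarT2 R]_(p in @torus2H R) g p <=
  \int[@sphere3_measure R]_(y in @sphere3 R) h y.
Proof.
move=> mg g0 mh h0 gh; rewrite integral_mkcond.
rewrite [leLHS](@fubini_tonelli2 _ _ _ _ _ (@sphere3_measure R) (@sphere3_measure R)).
- rewrite [leRHS]integral_mkcond; apply: ge0_le_integral => //.
  + by move=> y _; apply: integral_ge0 => x _; rewrite erestrict_ge0.
  + apply: measurable_fun_fubini_tonelli_G => [|p]; last by rewrite erestrict_ge0.
    apply/(measurable_restrictT _ _).1; first exact: measurable_torus2H.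
    exact: measurable_funTS.
  + apply/(measurable_restrictT _ _).1; first exact: measurable_sphere3.
    exact: measurable_funTS.
  move=> y _; rewrite /fubini_G patchE; case: ifPn => [/set_mem yS|yS].
    apply: le_trans (gh y yS); rewrite [leRHS]integral_mkcond le_eqVlt.
    apply/orP; left; apply/eqP/eq_integral => x _; rewrite !patchE.
    congr (if _ then _ else _); apply/idP/idP; rewrite !inE /torus2H/=; first by case.
    by split.
  rewrite integral0_eq// => x _; rewrite patchE ifN//.
  by apply: contra yS; rewrite !inE => -[].
- apply/(measurable_restrictT _ _).1; first exact: measurable_torus2H.
  exact: measurable_funTS.
- by move=> p; rewrite erestrict_ge0.
Qed.

(** The positive part of the logarithm is at most [ln C]; at q = 0 both sides are +oo. *)
Lemma abse_elog_norm_le (q : quat R) (C : R) : (1 <= C)%R -> (qnorm q <= C)%R ->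
  `|elog_norm q| <= nlog (qnorm q) + (ln C)%:E.
Proof.
move=> C1 qC; rewrite /elog_norm; case: ifPn => [/eqP->|q0].
  by rewrite /nlog lexx addye// leey.
have {}q0 : (0 < qnorm q)%R by rewrite lt_def q0 qnorm_ge0.
have lC : (ln (qnorm q) <= ln C)%R by rewrite ler_ln ?posrE// (lt_le_trans q0).
have lC0 : (0 <= ln C)%R by exact: ln_ge0.
rewrite /nlog [(qnorm q <= 0)%R]leNgt q0/= lee_fin ler_norml.
have m0 : (0 <= Num.max 0 (- ln (qnorm q)))%R by rewrite le_max lexx.
have m1 : (- ln (qnorm q) <= Num.max 0 (- ln (qnorm q)))%R by rewrite le_max lexx orbT.
move: (Num.max _ _) m0 m1 => m ? ?; lra.
Qed.

Lemma sum_ord_trunc (V : nmodType) (n d : nat) (F : nat -> V) : (d < n)%N ->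
  (forall l, (d < l < n)%N -> F l = 0%R) -> (\sum_(l < n) F l = \sum_(l < d.+1) F l)%R.
Proof.
move=> dn F0; rewrite -!(big_mkord xpredT F) (big_cat_nat (n := d.+1))//=.
rewrite [X in (_ + X)%R]big_nat_cond [X in (_ + X)%R]big1 ?addr0// => l.
by rewrite andbT => /F0.
Qed.

(** For fixed y this is a one-variable polynomial in x whose right coefficients are polynomials in
    y. *)
Lemma qpoly2E n1 n2 a x y : qpoly2 n1 n2 a x y =
  (\sum_(l1 < n1) qmul (qexp x l1) (\sum_(l2 < n2) qmul (qexp y l2) (a l1 l2)))%R.
Proof.
rewrite /qpoly2 qaddE; apply: eq_bigr => l1 _; rewrite qmul_sumr.
by apply: eq_bigr => l2 _; rewrite qmulA.
Qed.

Lemma measurable_qpoly2 n1 n2 a :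
  measurable_fun setT (fun p : quat R * quat R => qpoly2 n1 n2 a p.1 p.2).
Proof.
under eq_fun do rewrite qpoly2E.
apply: measurable_qsum => l1; apply: measurable_qmul.
  by apply: measurable_qexp; exact: measurable_fst.
apply: measurable_qsum => l2; apply: measurable_qmul; last exact: measurable_cst.
by apply: measurable_qexp; exact: measurable_snd.
Qed.

Lemma measurable_elog_norm d (T : measurableType d) (f : T -> quat R) :
  measurable_fun setT f -> measurable_fun setT (fun t => elog_norm (f t)).
Proof.
move=> mf; have mn := measurable_qnorm mf.
apply: measurable_fun_ifT.
- by apply: measurable_fun_eqr => //; exact: measurable_cst.
- exact: measurable_cst.
- by apply/measurable_EFinP; apply: measurableT_comp => //; exact: measurable_ln.
Qed.

End TwoVariables.

(** * Integrability of log |P| over the torus *)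

Theorem theorem7p1 (R : realType) (n1 n2 : nat) (a : nat -> nat -> quat R)
  (ha : exists l1 l2, (l1 < n1)%N /\ (l2 < n2)%N /\ a l1 l2 <> @qzero R) :
  (@haarT2 R).-integrable (@torus2H R)
    (fun p => elog_norm (qpoly2 n1 n2 a p.1 p.2)).
Proof.
have [l1 [l2 [l1n [l2n /eqP al]]]] := ha.
(* [d1] is the degree in x, the largest row index with a nonzero coefficient. *)
pose top1 l := (l < n1)%N && [exists m : 'I_n2, a l m != 0].
have ex1 : exists l, top1 l.
  by exists l1; rewrite /top1 l1n; apply/existsP; exists (Ordinal l2n).
have ub1 l : top1 l -> (l <= n1)%N by case/andP => /ltnW.
case: (ex_maxnP ex1 ub1) => d1 /andP[d1n /existsP[m am]] max1.
(* [d2] is the degree in y of row [d1], so the top coefficient of P(., y) is a polynomial in y with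
   nonzero leading coefficient [a d1 d2]. *)
pose top2 l := (l < n2)%N && (a d1 l != 0).
have ex2 : exists l, top2 l by exists m; rewrite /top2 ltn_ord.
have ub2 l : top2 l -> (l <= n2)%N by case/andP => /ltnW.
case: (ex_maxnP ex2 ub2) => d2 /andP[d2n ad] max2 {ub1 ub2 ex1 ex2 am m}.
pose B (y : quat R) l := \sum_(l2 < n2) qmul (qexp y l2) (a l l2).
have BE y : B y d1 = rightpoly d2 (a d1) y.
  apply: (@sum_ord_trunc _ _ _ (fun l => qmul (qexp y l) (a d1 l))) => // l /andP[dl ln].
  suff -> : a d1 l = 0 by rewrite qmul0.
  apply/eqP/negPn/negP => al0; have := max2 l.
  by rewrite /top2 ln al0 => /(_ isT); rewrite leqNgt dl.
have PE x y : qpoly2 n1 n2 a x y = rightpoly d1 (B y) x.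
  rewrite qpoly2E.
  apply: (@sum_ord_trunc _ _ _ (fun l => qmul (qexp x l) (B y l))) => // l /andP[dl ln].
  suff -> : B y l = 0 by rewrite qmul0.
  rewrite /B big1// => k _; suff -> : a l k = 0 by rewrite qmul0.
  apply/eqP/negPn/negP => al0; have := max1 l; rewrite /top1 ln => /(_ _).
  have -> : [exists m : 'I_n2, a l m != 0] by apply/existsP; exists k.
  by move=> /(_ isT); rewrite leqNgt dl.
(* [C] bounds the coefficient sum of P(., y) for every unit y, and hence |P| on the torus; the 1
   makes [ln C] nonnegative. *)
pose C := 1 + \sum_(l < d1.+1) \sum_(k < n2) qnorm (a l k).
have C1 : 1 <= C.
  by rewrite lerDl; do 2![apply: sumr_ge0 => ? _]; exact: qnorm_ge0.
have BC y : sphere3 y -> \sum_(l < d1.+1) qnorm (B y l) <= C.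
  move=> y1; rewrite -[leLHS]add0r lerD//; apply: ler_sum => l _.
  rewrite (le_trans (qnorm_sum _ _ _))//; apply: ler_sum => k _.
  by rewrite qnormM qnormX// mul1r.
have mP := measurable_qpoly2 n1 n2 a.
have [K K0 KB] := integral_nlog_rightpoly_le d1 C1.
pose h (y : quat R) := (K%:E + K%:E * nlog (qnorm (rightpoly d2 (a d1) y)))%E.
have mnlogd : measurable_fun setT (fun y : quat R => nlog (qnorm (rightpoly d2 (a d1) y))).
  apply: measurable_nlog_comp; apply: measurable_qnorm; exact: measurable_rightpoly.
have mKn : measurable_fun setT
    (fun y : quat R => (K%:E * nlog (qnorm (rightpoly d2 (a d1) y)))%E).
  exact: measurable_funeM.
have Kn0 y : (0 <= K%:E * nlog (qnorm (rightpoly d2 (a d1) y)))%E.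
  by rewrite mule_ge0 ?lee_fin ?(ltW K0)// nlog_ge0.
have mnlogP : measurable_fun setT
    (fun p : quat R * quat R => nlog (qnorm (qpoly2 n1 n2 a p.1 p.2))).
  by apply: measurable_nlog_comp; exact: measurable_qnorm.
(* The inner integral is at most [h y], an affine function of log^- of the top coefficient, which is
   integrable by the one-variable case. *)
have Pfin : (\int[@haarT2 R]_(p in @torus2H R)
    nlog (qnorm (qpoly2 n1 n2 a p.1 p.2)) < +oo)%E.
  apply: (@le_lt_trans _ _ (\int[@sphere3_measure R]_(y in @sphere3 R) h y)%E).
    apply: integral_torus2H_le => //.
    - by move=> p; exact: nlog_ge0.
    - by apply: emeasurable_funD => //; exact: measurable_cst.
    - by move=> y; rewrite adde_ge0// lee_fin ltW.
    move=> y y1; rewrite /h -BE; apply: le_trans (KB (B y) (BC y y1)).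
    by under eq_integral do rewrite PE.
  have mS := @measurable_sphere3 R.
  rewrite ge0_integralD//; last 2 first.
  - by move=> y _; rewrite lee_fin ltW.
  - exact: measurable_funTS.
  rewrite integral_cst// ge0_integralZl_EFin ?(ltW K0)//; last 2 first.
  - by move=> y _; exact: nlog_ge0.
  - exact: measurable_funTS.
  rewrite lte_add_pinfty// lte_mul_pinfty ?lee_fin ?(ltW K0)//.
    by rewrite -ge0_fin_numE// fin_num_measure.
  exact: integral_nlog_rightpoly_lty.
have mT := @measurable_torus2H R.
apply/integrableP; split.
  by apply: measurable_funTS; exact: measurable_elog_norm.
have lnC0 : 0 <= ln C by exact: ln_ge0.
(* [haarT2] is only a set function; the convertible [sfprod] carries the measure structure. *)
pose H : {measure set _ -> \bar R} := sfprod (@sphere3_measure R) (@sphere3_measure R).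
have -> : @haarT2 R = H by [].
apply: (@le_lt_trans _ _ (\int[H]_(p in @torus2H R)
    (nlog (qnorm (qpoly2 n1 n2 a p.1 p.2)) + (ln C)%:E))%E).
  apply: ge0_le_integral => //.
  - apply: measurableT_comp => //; apply: measurable_funTS; exact: measurable_elog_norm.
  - apply: measurable_funTS; apply: emeasurable_funD => //; exact: measurable_cst.
  move=> [x y] [x1 y1]; apply: abse_elog_norm_le => //=.
  by rewrite PE (le_trans (qnorm_rightpoly_le _ _ _))// BC.
rewrite ge0_integralD//; last 2 first.
- by move=> p _; exact: nlog_ge0.
- exact: measurable_funTS.
by rewrite lte_add_pinfty// integral_cst// lte_mul_pinfty ?lee_fin// haarT2_torus_lty.
Qed.
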